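(* Let $(w^*,\lambda^* )$, $w^*=(x^*,u^* )$, be a KKT point of the optimal control problem (OCP) described in the context that satisfies LICQ and SOSC. Then the asymptotic linear contraction rate at $w^*$ of the generalized Gauss-Newton (GGN) multiple shooting iterates, obtained via $w^+=\Pi_{\mathrm{MS}}(w)$, is equal to the asymptotic linear contraction rate at $w^*$ of the GGN differential dynamic programming iterates, obtained via $w^+=\Pi_{\mathrm{DDP}}(w)$.
   Context: OCP. Let $N\ge 1$, $x=(x_0,\dots,x_N)$ with $x_i\in\mathbb{R}^{n_x}$, $u=(u_0,\dots,u_{N-1})$ with $u_i\in\mathbb{R}^{n_u}$, $w=(x,u)$, and let $\bar{\bar x}_0\in\mathbb{R}^{n_x}$ be given. Minimize $V(w)=\sum_{i=0}^{N-1} l_i(x_i,u_i)+l_N(x_N)$ over $w$ subject to $x_0=\bar{\bar x}_0$ and $x_{i+1}=f_i(x_i,u_i)$, $i=0,\dots,N-1$. The functions $l_i$ and $l_N$ are convex. The constraints are written $F(x,u)=0$, where $F(x,u)$ stacks $\bar{\bar x}_0-x_0$ and $f_i(x_i,u_i)-x_{i+1}$, $i=0,\dots,N-1$. The Lagrangian is $V(w)+\lambda^\top F(w)$. A KKT point $(w^*,\lambda^* )$ satisfies $F(w^* )=0$ and $\nabla V(w^* )+\frac{\partial F}{\partial w}(w^* )^\top\lambda^*=0$. LICQ: $\frac{\partial F}{\partial w}(w^* )$ has full row rank. SOSC: the Hessian in $w$ of the Lagrangian at $(w^*,\lambda^* )$ is positive definite on the null space of $\frac{\partial F}{\partial w}(w^*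 )$. Linearization at $\bar w=(\bar x,\bar u)$. For $i=0,\dots,N-1$: $A_i=\frac{\partial f_i}{\partial x_i}(\bar x_i,\bar u_i)$, $B_i=\frac{\partial f_i}{\partial u_i}(\bar x_i,\bar u_i)$, $\bar f_i=f_i(\bar x_i,\bar u_i)$, $a_i=\bar f_i-A_i\bar x_i-B_i\bar u_i$; GGN Hessian blocks $\begin{bmatrix}Q_i&S_i^\top\\S_i&R_i\end{bmatrix}=\nabla^2_{(x_i,u_i)}l_i(\bar x_i,\bar u_i)$; $q_i=\nabla_{x_i}l_i(\bar x_i,\bar u_i)-Q_i\bar x_i-S_i^\top\bar u_i$, $r_i=\nabla_{u_i}l_i(\bar x_i,\bar u_i)-S_i\bar x_i-R_i\bar u_i$; $P_N=\nabla^2 l_N(\bar x_N)$, $p_N=\nabla l_N(\bar x_N)-P_N\bar x_N$. Riccati recursion, for $i=N-1,\dots,0$: $K_i=-(R_i+B_i^\top P_{i+1}B_i)^{-1}(S_i+B_i^\top P_{i+1}A_i)$; $\kappa_i^{0}=-(R_i+B_i^\top P_{i+1}B_i)^{-1}\big(r_i+B_i^\top(P_{i+1}a_i+p_{i+1})\big)$; $P_i=Q_i+A_i^\top P_{i+1}A_i+(S_i^\top+A_i^\top P_{i+1}B_i)K_i$; $p_i=q_i+A_i^\top(P_{i+1}a_i+p_{i+1})+K_i^\top\big(r_i+B_i^\top(P_{i+1}a_i+p_{i+1})\big)$. The resulting affine feedback law of the quadratic subproblem is $u_i=\kappa_i^0+K_ix_i$; it is written relative to the linearization point as $u_i=\bar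 u_i+k_i+K_i(x_i-\bar x_i)$, i.e. $k_i=\kappa^0_i+K_i\bar x_i-\bar u_i$. The $K_i,k_i$ depend on $\bar w$ only. Residual blocks. $\hat F(x,u;\bar w)$ stacks $\bar{\bar x}_0-x_0$ and $\bar f_i+A_i(x_i-\bar x_i)+B_i(u_i-\bar u_i)-x_{i+1}$, $i=0,\dots,N-1$. $G(x,u;\bar w)$ stacks $\bar u_i+k_i(\bar w)+K_i(\bar w)(x_i-\bar x_i)-u_i$, $i=0,\dots,N-1$. Iterations. $\Pi_{\mathrm{MS}}(\bar w)$ is the solution $w=(x,u)$ of $R_{\mathrm{MS}}(w;\bar w)=(\hat F(x,u;\bar w),G(x,u;\bar w))=0$. $\Pi_{\mathrm{DDP}}(\bar w)$ is the solution $w=(x,u)$ of $R_{\mathrm{DDP}}(w;\bar w)=(F(x,u),G(x,u;\bar w))=0$. Asymptotic linear contraction rate. For an iteration $z^+=\Pi(z)$ given by $R(\Pi(\bar z);\bar z)=0$ with fixed point $z^*$, it is the spectral radius $\rho(J(z^* ))$ of $J(z^* )=-\big(\frac{\partial R}{\partial z}(z^*;z^* )\big)^{-1}\frac{\partial R}{\partial\bar z}(z^*;z^* )$, which is the derivative of $\Pi$ at $z^*$. Standing assumptions. The matrices inverted in the Riccati recursion are invertible at $\bar w=w^*$ (hence nearby), so that the iterations are well defined near $w^*$; the functions $f_i,l_i,l_N$ are smooth enough that the residual maps are twice continuously differentiable near the fixed point. *)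

(* Defs.v *)
From HB Require Import structures.
From mathcomp Require Import all_boot all_order all_algebra.
From mathcomp Require Import complex.
From mathcomp Require Import all_classical all_reals all_analysis.

Set Implicit Arguments.
Unset Strict Implicit.
Unset Printing Implicit Defensive.
Import Order.TTheory GRing.Theory Num.Theory.
Import numFieldNormedType.Exports.

Local Open Scope classical_set_scope.
Local Open Scope ring_scope.

Section Calculus.
Variable R : realType.

(* Column-vector convention, [jac f z] acts on the left; the library's
   [jacobian] is the transposed matrix, for maps between row vectors. *)
Definition jac m n (f : 'cV[R]_n -> 'cV[R]_m) (z : 'cV[R]_n) : 'M[R]_(m, n) :=
  \matrix_(i, j) 'D_(delta_mx j 0) f z i 0.

Definition grad n (g : 'cV[R]_n -> R) (z : 'cV[R]_n) : 'cV[R]_n :=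
  \col_j 'D_(delta_mx j 0) g z.

Definition hess n (g : 'cV[R]_n -> R) (z : 'cV[R]_n) : 'M[R]_n :=
  jac (grad g) z.

(* [f] is k times continuously differentiable on a neighbourhood of [p].  In
   finite dimension it is enough to iterate on the directional derivatives. *)
Fixpoint Ck_near (k : nat) (V W : normedModType R) (f : V -> W) (p : V) : Prop :=
  if k is k'.+1 then
    (\forall z \near p, differentiable f z) /\
    (forall v : V, Ck_near k' (fun z => 'D_v f z) p)
  else \forall z \near p, {for z, continuous f}.

Definition spectral_radius n (A : 'M[R]_n) : R :=
  sup [set Normc.normc c | c in
        [set c : R[i] | eigenvalue (map_mx (real_complex R) A) c]].

End Calculus.

Section Iteration.
Variables (R : realType) (n : nat).

(* [res z zb] is the residual R(z; zb) of the implicitly defined iteration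
   z = Pi(zb), where zb is the current iterate and z the next one. *)
Variable res : 'cV[R]_n -> 'cV[R]_n -> 'cV[R]_n.

(* The default [zb] is only returned when there is no solution. *)
Definition iteration (zb : 'cV[R]_n) : 'cV[R]_n :=
  xget zb [set z | res z zb = 0].

Definition iteration_matrix (z : 'cV[R]_n) : 'M[R]_n :=
  - (invmx (jac (res ^~ z) z) *m jac (res z) z).

Definition contraction_rate (z : 'cV[R]_n) : R :=
  spectral_radius (iteration_matrix z).

(* The presuppositions of [contraction_rate]: near [z] the iteration is given
   by the unique zero of the residual, [z] is a fixed point, and the matrix
   inverted in [iteration_matrix] is invertible. *)
Definition well_defined_at (z : 'cV[R]_n) : Prop :=
  [/\ \forall zb \near z, [set z' | res z' zb = 0] = [set iteration zb],
      iteration z = z &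
      jac (res ^~ z) z \in unitmx].

End Iteration.

(* The cost and dynamics of stage [i] take the stacked argument
   [col_mx x_i u_i]. *)
Record ocp (R : realType) (N nx nu : nat) := Ocp {
  xinit : 'cV[R]_nx;
  dyn : 'I_N -> 'cV[R]_(nx + nu) -> 'cV[R]_nx;
  stage_cost : 'I_N -> 'cV[R]_(nx + nu) -> R;
  final_cost : 'cV[R]_nx -> R
}.

Notation xdim N nx := (\sum_(i < N.+1) nx)%N.
Notation udim N nu := (\sum_(i < N) nu)%N.
Notation wdim N nx nu := (xdim N nx + udim N nu)%N.

Section OCP.
Variables (R : realType) (N nx nu : nat) (P : ocp R N nx nu).

Implicit Types w wb : 'cV[R]_(wdim N nx nu).

Definition state w (i : 'I_N.+1) : 'cV[R]_nx := submxcol (usubmx w) i.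
Definition control w (i : 'I_N) : 'cV[R]_nu := submxcol (dsubmx w) i.

Definition cur (i : 'I_N) : 'I_N.+1 := widen_ord (leqnSn N) i.
Definition nxt (i : 'I_N) : 'I_N.+1 := lift ord0 i.

Definition stage w (i : 'I_N) : 'cV[R]_(nx + nu) :=
  col_mx (state w (cur i)) (control w i).

Definition objective w : R :=
  \sum_(i < N) stage_cost P i (stage w i) + final_cost P (state w ord_max).

Definition stack_constraints (c0 : 'cV[R]_nx) (c : 'I_N -> 'cV[R]_nx) :
    'cV[R]_(xdim N nx) :=
  \mxcol_(i < N.+1) (if unlift ord0 i is Some j then c j else c0).

Definition constraints w : 'cV[R]_(xdim N nx) :=
  stack_constraints (xinit P - state w ord0)
    (fun i => dyn P i (stage w i) - state w (nxt i)).

Definition lagrangian (lam : 'cV[R]_(xdim N nx)) w : R :=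
  objective w + (lam^T *m constraints w) 0 0.

Definition KKT w (lam : 'cV[R]_(xdim N nx)) : Prop :=
  constraints w = 0 /\
  grad objective w + (jac constraints w)^T *m lam = 0.

Definition LICQ w : Prop := row_free (jac constraints w).

Definition SOSC w (lam : 'cV[R]_(xdim N nx)) : Prop :=
  forall d : 'cV[R]_(wdim N nx nu), jac constraints w *m d = 0 -> d != 0 ->
    0 < (d^T *m hess (lagrangian lam) w *m d) 0 0.

Section Linearization.
Variable wb : 'cV[R]_(wdim N nx nu).

Definition lin_A i : 'M[R]_nx := lsubmx (jac (dyn P i) (stage wb i)).
Definition lin_B i : 'M[R]_(nx, nu) := rsubmx (jac (dyn P i) (stage wb i)).
Definition lin_f i : 'cV[R]_nx := dyn P i (stage wb i).
Definition lin_a i : 'cV[R]_nx :=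
  lin_f i - lin_A i *m state wb (cur i) - lin_B i *m control wb i.

Definition ggn_hess i : 'M[R]_(nx + nu) := hess (stage_cost P i) (stage wb i).
Definition ggn_Q i : 'M[R]_nx := ulsubmx (ggn_hess i).
Definition ggn_S i : 'M[R]_(nu, nx) := dlsubmx (ggn_hess i).
Definition ggn_R i : 'M[R]_nu := drsubmx (ggn_hess i).

Definition ggn_q i : 'cV[R]_nx :=
  usubmx (grad (stage_cost P i) (stage wb i))
  - ggn_Q i *m state wb (cur i) - (ggn_S i)^T *m control wb i.
Definition ggn_r i : 'cV[R]_nu :=
  dsubmx (grad (stage_cost P i) (stage wb i))
  - ggn_S i *m state wb (cur i) - ggn_R i *m control wb i.

Definition final_P : 'M[R]_nx := hess (final_cost P) (state wb ord_max).
Definition final_p : 'cV[R]_nx :=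
  grad (final_cost P) (state wb ord_max) - final_P *m state wb ord_max.

(* The next four definitions give stage [i] of the Riccati recursion in terms
   of the pair [Pp = (P_(i+1), p_(i+1))]. *)
Definition riccati_M i (Pp : 'M[R]_nx * 'cV[R]_nx) : 'M[R]_nu :=
  ggn_R i + (lin_B i)^T *m Pp.1 *m lin_B i.

Definition riccati_K i (Pp : 'M[R]_nx * 'cV[R]_nx) : 'M[R]_(nu, nx) :=
  - (invmx (riccati_M i Pp) *m (ggn_S i + (lin_B i)^T *m Pp.1 *m lin_A i)).

Definition riccati_kappa i (Pp : 'M[R]_nx * 'cV[R]_nx) : 'cV[R]_nu :=
  - (invmx (riccati_M i Pp) *m
     (ggn_r i + (lin_B i)^T *m (Pp.1 *m lin_a i + Pp.2))).

Definition riccati_step i (Pp : 'M[R]_nx * 'cV[R]_nx) :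
    'M[R]_nx * 'cV[R]_nx :=
  (ggn_Q i + (lin_A i)^T *m Pp.1 *m lin_A i
     + ((ggn_S i)^T + (lin_A i)^T *m Pp.1 *m lin_B i) *m riccati_K i Pp,
   ggn_q i + (lin_A i)^T *m (Pp.1 *m lin_a i + Pp.2)
     + (riccati_K i Pp)^T *m
       (ggn_r i + (lin_B i)^T *m (Pp.1 *m lin_a i + Pp.2))).

(* [riccati i] is the pair (P_i, p_i); see [riccati_final] and [riccatiE]. *)
Definition riccati (i : 'I_N.+1) : 'M[R]_nx * 'cV[R]_nx :=
  foldr riccati_step (final_P, final_p) (drop i (enum 'I_N)).

Lemma riccati_final : riccati ord_max = (final_P, final_p).
Proof. by rewrite /riccati drop_oversize// size_enum_ord. Qed.

Lemma riccatiE (i : 'I_N) :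
  riccati (cur i) = riccati_step i (riccati (nxt i)).
Proof.
by rewrite /riccati (drop_nth i) ?size_enum_ord//= nth_ord_enum.
Qed.

Definition gain_K i : 'M[R]_(nu, nx) := riccati_K i (riccati (nxt i)).
Definition gain_kappa i : 'cV[R]_nu := riccati_kappa i (riccati (nxt i)).
Definition gain_k i : 'cV[R]_nu :=
  gain_kappa i + gain_K i *m state wb (cur i) - control wb i.

(* The matrices inverted in the Riccati recursion are invertible. *)
Definition riccati_regular : Prop :=
  forall i : 'I_N, riccati_M i (riccati (nxt i)) \in unitmx.

End Linearization.

Definition lin_constraints w wb : 'cV[R]_(xdim N nx) :=
  stack_constraints (xinit P - state w ord0)
    (fun i => lin_f wb i + lin_A wb i *m (state w (cur i) - state wb (cur i))
              + lin_B wb i *m (control w i - control wb i) - state w (nxt i)).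

Definition policy_residual w wb : 'cV[R]_(udim N nu) :=
  \mxcol_(i < N) (control wb i + gain_k wb i
    + gain_K wb i *m (state w (cur i) - state wb (cur i)) - control w i).

Definition res_MS w wb : 'cV[R]_(wdim N nx nu) :=
  col_mx (lin_constraints w wb) (policy_residual w wb).

Definition res_DDP w wb : 'cV[R]_(wdim N nx nu) :=
  col_mx (constraints w) (policy_residual w wb).

(* The last two conditions are joint in the argument [z = (w, wb)]. *)
Definition smooth_near w : Prop :=
  [/\ forall i : 'I_N, Ck_near 2 (dyn P i) (stage w i),
      forall i : 'I_N, Ck_near 2 (stage_cost P i) (stage w i),
      Ck_near 2 (final_cost P) (state w ord_max),
      Ck_near 2 (fun z : 'cV[R]_(wdim N nx nu) * 'cV[R]_(wdim N nx nu) =>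
                   res_MS z.1 z.2) (w, w) &
      Ck_near 2 (fun z : 'cV[R]_(wdim N nx nu) * 'cV[R]_(wdim N nx nu) =>
                   res_DDP z.1 z.2) (w, w)].

Definition convex_costs : Prop :=
  (forall i : 'I_N, convex_function [set: 'cV[R]_(nx + nu)] (stage_cost P i)) /\
  convex_function [set: 'cV[R]_nx] (final_cost P).

End OCP.

(* Main.v *)
Require Import Defs.
From HB Require Import structures.
From mathcomp Require Import all_boot all_order all_algebra.
From mathcomp Require Import complex ring.
From mathcomp Require Import all_classical all_reals all_analysis.

(* At the KKT point [ws] both iterations have the same iteration matrix, not
   only the same contraction rate.  The two residuals share the policy block, and
   the derivative of the dynamics block in the new iterate is that of the
   constraints for both.  In the current iterate [wb], the dynamics block of DDP
   is constant, and that of multiple shooting, [f wb + f' wb (ws - wb) - ws],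
   has derivative [f' ws - f' ws = 0] at [wb = ws].

   That [ws] is a fixed point amounts to [k_i = 0] at [ws].  By backward
   induction, the Riccati recursion reproduces the multipliers,
   [P_i x_i + p_i = lambda_i], and then stationarity of the Lagrangian in [u_i]
   says that [u_i] is the value of the affine feedback law at [x_i].  The
   induction needs the [P_i] to be symmetric, hence Hessians to be. *)

Set Implicit Arguments.
Unset Strict Implicit.
Unset Printing Implicit Defensive.
Import Order.TTheory GRing.Theory Num.Theory.
Import numFieldNormedType.Exports.

Local Open Scope classical_set_scope.
Local Open Scope ring_scope.

(** * Matrices acting on column vectors, and squared norms *)

Section ColumnVectors.
Variable R : realType.

Lemma eq_mulmx_cV m n (A B : 'M[R]_(m, n)) :
  (forall v : 'cV[R]_n, A *m v = B *m v) -> A = B.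
Proof.
move=> AB; apply/matrixP => i j.
by have /colP/(_ i) := AB (delta_mx j 0); rewrite -!colE !mxE.
Qed.

Lemma unitmx_kernel0 n (A : 'M[R]_n) :
  (forall v : 'cV[R]_n, A *m v = 0 -> v = 0) -> A \in unitmx.
Proof.
(* [kermx] is the left kernel, hence the passage to the transpose. *)
move=> kerA; rewrite -unitmx_tr -row_free_unit -kermx_eq0.
apply/rowV0P => v /sub_kermxP vA; apply: trmx_inj; rewrite trmx0; apply: kerA.
by apply: trmx_inj; rewrite trmx_mul trmxK vA trmx0.
Qed.

Lemma addmxE m n (A B : 'M[R]_(m, n)) i j : (A + B) i j = A i j + B i j.
Proof. by rewrite mxE. Qed.

Lemma dotD m (a b x : 'cV[R]_m) :
  ((a + b)^T *m x) 0 0 = (a^T *m x) 0 0 + (b^T *m x) 0 0.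
Proof. by rewrite linearD mulmxDl mxE. Qed.

Lemma dotB m (a b x : 'cV[R]_m) :
  ((a - b)^T *m x) 0 0 = (a^T *m x) 0 0 - (b^T *m x) 0 0.
Proof. by rewrite linearB mulmxBl !mxE. Qed.

Lemma sqmx_eq0 m (v : 'cV[R]_m) : (v^T *m v) 0 0 = 0 -> v = 0.
Proof.
rewrite mxE => /psumr_eq0P v0; apply/colP => k; rewrite mxE.
have := v0 _ k isT; rewrite mxE -expr2 => v2.
by apply/eqP; rewrite -sqrf_eq0 v2// => j _; rewrite mxE -expr2 sqr_ge0.
Qed.

Lemma sqmx_ge0 m (v : 'cV[R]_m) : 0 <= (v^T *m v) 0 0.
Proof. by rewrite mxE sumr_ge0// => j _; rewrite mxE -expr2 sqr_ge0. Qed.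

End ColumnVectors.

(** * Derivatives of linear maps, compositions and products; mean values along a line *)

Section MatrixCalculus.
Variable R : realType.

(** In finite dimension a linear map is a finite sum of coordinate functions [M i j] times the fixed
    vectors [f (delta_mx i j)]. *)
Lemma differentiable_linear_mx m n (W : normedModType R)
    (f : 'M[R]_(m, n) -> W) x : linear f -> differentiable f x.
Proof.
move=> lf; pose g : {linear 'M[R]_(m, n) -> W} :=
  HB.pack f (GRing.isLinear.Build R 'M[R]_(m, n) W _ f lf).
have -> : f =
    \sum_(i < m) \sum_(j < n)
      (fun M : 'M[R]_(m, n) => M i j *: f (delta_mx i j)).
  apply/funext => M; rewrite -[f M]/(g M) [in LHS](matrix_sum_delta M).
  rewrite linear_sum fct_sumE; apply: eq_bigr => i _.
  by rewrite linear_sum fct_sumE; apply: eq_bigr => j _; rewrite linearZ.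
apply: differentiable_sum => i; apply: differentiable_sum => j.
exact/differentiableZl/differentiable_coord.
Qed.

Lemma diff_linear_mx m n (W : normedModType R) (f : 'M[R]_(m, n) -> W) x :
  linear f -> 'd f x = f :> (_ -> _).
Proof.
move=> lf; pose g : {linear 'M[R]_(m, n) -> W} :=
  HB.pack f (GRing.isLinear.Build R 'M[R]_(m, n) W _ f lf).
apply: (@diff_lin _ _ _ g) => y.
exact/differentiable_continuous/differentiable_linear_mx.
Qed.

Lemma derive_comp (U V W : normedModType R) (f : U -> V) (g : V -> W) x v :
  differentiable f x -> differentiable g (f x) ->
  'D_v (g \o f) x = 'D_('D_v f x) g (f x).
Proof.
move=> df dg; rewrite (deriveE _ (differentiable_comp df dg)) diff_comp//.
by rewrite (deriveE _ df) (deriveE _ dg).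
Qed.

Lemma derive_linear_mx m n (W : normedModType R) (f : 'M[R]_(m, n) -> W) x v :
  linear f -> 'D_v f x = f v.
Proof.
move=> lf; rewrite (deriveE _ (differentiable_linear_mx x lf)).
by rewrite diff_linear_mx.
Qed.

Lemma derive_linear_comp (V W : normedModType R) m n
    (l : 'M[R]_(m, n) -> W) (f : V -> 'M[R]_(m, n)) x v :
  linear l -> differentiable f x -> 'D_v (l \o f) x = l ('D_v f x).
Proof.
move=> ll df; rewrite (derive_comp _ df (differentiable_linear_mx (f x) ll)).
exact: derive_linear_mx.
Qed.

Lemma jac_mul m n (f : 'cV[R]_n -> 'cV[R]_m) z v :
  differentiable f z -> jac f z *m v = 'D_v f z.
Proof.
move=> df; rewrite deriveE// [in RHS](matrix_sum_delta v) linear_sum.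
apply/colP => i; rewrite mxE summxE; apply: eq_bigr => j _.
by rewrite big_ord1 linearZ !mxE deriveE// mulrC.
Qed.

Lemma grad_mul n (g : 'cV[R]_n -> R) z v :
  differentiable g z -> ((grad g z)^T *m v) 0 0 = 'D_v g z.
Proof.
move=> df; rewrite deriveE// [in RHS](matrix_sum_delta v) linear_sum.
rewrite mxE; apply: eq_bigr => j _.
by rewrite big_ord1 linearZ !mxE deriveE// mulrC.
Qed.

(** In the product rule the term with the derivative of [M] carries the factor [y x], so it drops
    out. The intended use is [f' wb *m (ws - wb)] at [wb = ws]. *)
Lemma derive_mulmx_zero (V : normedModType R) m n (M : V -> 'M[R]_(m, n))
    (y : V -> 'cV[R]_n) x v :
  (forall i j, differentiable (fun z => M z i j) x) -> differentiable y x ->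
  y x = 0 ->
  derivable (fun z => M z *m y z) x v /\
  'D_v (fun z => M z *m y z) x = M x *m 'D_v y x.
Proof.
move=> dM dy y0.
have dyj j : derivable (fun z => y z j 0) x v.
  by apply/(derivable_mxP y x v).1; exact: diff_derivable.
have cf i : (fun z => (M z *m y z) i 0) =
    \sum_(j < n) ((fun z => M z i j) * (fun z => y z j 0)).
  by apply/funext => z; rewrite mxE fct_sumE.
have dMy i j : is_derive x v ((fun z => M z i j) * (fun z => y z j 0))
    (M x i j * 'D_v (fun z => y z j 0) x).
  apply: DeriveDef; first by apply: derivableM => //; exact: diff_derivable.
  rewrite deriveM//; last exact: diff_derivable.
  by rewrite y0 mxE scale0r addr0.
have d : derivable (fun z => M z *m y z) x v.
  apply/derivable_mxP => i j; rewrite ord1 cf.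
  by apply: derivable_sum => k; exact: ex_derive.
split; first exact: d.
rewrite (derive_mx d); apply/colP => i; rewrite !mxE cf derive_sum.
  apply: eq_bigr => j _; rewrite (derive_val (is_derive := dMy i j)).
  by rewrite (derive_mx (diff_derivable dy)) mxE.
by move=> j; have [] := dMy i j.
Qed.

Lemma is_derive_line (V W : normedModType R) (f : V -> W) x v (s : R) :
  derivable f (x + s *: v) v ->
  is_derive s 1 (fun t : R => f (x + t *: v)) ('D_v f (x + s *: v)).
Proof.
(* Both difference quotients are the same function of [h], so derivability and the value transfer
   together. *)
have e : (fun h : R => h^-1 *:
             (((fun t : R => f (x + t *: v)) \o shift s) (h *: (1 : R))
             - f (x + s *: v)))
       = (fun h : R => h^-1 *: ((f \o shift (x + s *: v)) (h *: v)
             - f (x + s *: v))).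
  apply/funext => h; congr (_ *: (f _ - _)).
  by rewrite /= scalerDl [h *: 1]mulr1 addrCA.
by move=> df; apply: DeriveDef; rewrite /derivable /derive e.
Qed.

(** This is the one-variable mean value theorem for [f] restricted to the line through [x] in
    direction [v]. *)
Lemma MVT_derive (V : normedModType R) (f : V -> R) x v (h : R) :
  0 < h -> (forall s, s \in `[0, h] -> derivable f (x + s *: v) v) ->
  exists2 c, c \in `]0, h[ & f (x + h *: v) - f x = h * 'D_v f (x + c *: v).
Proof.
move=> h0 df.
have dl s : s \in `]0, h[ ->
    is_derive s 1 (fun t : R => f (x + t *: v)) ('D_v f (x + s *: v)).
  by move=> sI; apply/is_derive_line/df; exact: subset_itv_oo_cc.
have cl : {within `[0, h], continuous (fun t : R => f (x + t *: v))}.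
  apply: derivable_within_continuous => s sI.
  by have [] := is_derive_line (df s sI).
have [c cI e] := MVT h0 dl cl.
by exists c => //; move: e; rewrite scale0r addr0 subr0 mulrC.
Qed.

End MatrixCalculus.

(** * Equality of mixed second directional derivatives *)

Section MixedDerivatives.
Variables (R : realType) (V : normedModType R).

Lemma is_derive_shift_arg (W : normedModType R) (f : V -> W) x w v :
  derivable f (x + w) v ->
  is_derive x v (fun z => f (z + w)) ('D_v f (x + w)).
Proof.
have e : (fun h : R => h^-1 *: (((fun z => f (z + w)) \o shift x) (h *: v)
             - f (x + w)))
       = (fun h : R => h^-1 *: ((f \o shift (x + w)) (h *: v) - f (x + w))).
  by apply/funext => h; rewrite /= addrA.
by move=> df; apply: DeriveDef; rewrite /derivable /derive e.
Qed.

(** The mean value theorem is applied twice: along [u] to the increment [g] of [f] in direction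
    [h *: v], then along [v] to ['D_u f] at the intermediate point. *)
Lemma second_difference (f : V -> R) p u v (h : R) : 0 < h ->
  (forall s t, s \in `[0, h] -> t \in `[0, h] ->
     differentiable f (p + s *: u + t *: v) /\
     differentiable ('D_u f) (p + s *: u + t *: v)) ->
  exists c d, [/\ c \in `]0, h[, d \in `]0, h[ &
    f (p + h *: u + h *: v) - f (p + h *: u) - (f (p + h *: v) - f p)
    = h * (h * 'D_v ('D_u f) (p + c *: u + d *: v))].
Proof.
move=> h0 df.
have h00 : (0 : R) \in `[0, h] by rewrite in_itv /= lexx ltW.
have hh : h \in `[0, h] by rewrite in_itv /= lexx ltW.
pose g := (fun z => f (z + h *: v)) - f.
have dg s : s \in `[0, h] -> is_derive (p + s *: u) u g
    ('D_u f (p + s *: u + h *: v) - 'D_u f (p + s *: u)).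
  move=> sI; apply: is_deriveB.
    by apply/is_derive_shift_arg/diff_derivable; have [] := df _ _ sI hh.
  apply/derivableP/diff_derivable.
  by have [] := df _ _ sI h00; rewrite scale0r addr0.
have [s sI|c cI] := @MVT_derive R V g p u h h0.
  by have [] := dg _ sI.
have cI' := subset_itv_oo_cc cI.
rewrite (derive_val (is_derive := dg _ cI')).
have [t tI|d dI ->] := @MVT_derive R V ('D_u f) (p + c *: u) v h h0.
  by apply: diff_derivable; have [] := df _ _ cI' tI.
by move=> e; exists c, d; split=> //; rewrite -e /g.
Qed.

(** Schwarz's theorem. The second difference of [f] over a small parallelogram is symmetric in [u]
    and [v], so the two mixed derivatives take a common value, each at some point near [p]. By
    continuity each is within [e / 2] of its value at [p]. *)
Lemma derive_comm (f : V -> R) p u v :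
  (\forall z \near p, differentiable f z) ->
  (\forall z \near p, differentiable ('D_u f) z) ->
  (\forall z \near p, differentiable ('D_v f) z) ->
  {for p, continuous ('D_v ('D_u f))} -> {for p, continuous ('D_u ('D_v f))} ->
  'D_v ('D_u f) p = 'D_u ('D_v f) p.
Proof.
have triangle (a b x e : R) : `|a - x| < e / 2 -> `|b - x| < e / 2 ->
    `|a - b| <= e.
  move=> ax bx; apply: le_trans (ler_distD x a b) _.
  by rewrite (splitr e) [`|x - b|]distrC lerD// ltW.
have swap (a b c d : R) : a - b - (c - d) = a - c - (b - d).
  by rewrite -!addrA !opprD !opprK; congr (_ + _); rewrite addrCA.
move=> df duf dvf cuv cvu; apply/eqP; rewrite -subr_eq0 -normr_le0.
apply/ler_addgt0Pl => e e0; rewrite addr0.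
have e2 : 0 < e / 2 by rewrite divr_gt0.
have near_uv : \forall z \near p, [/\ differentiable f z,
    differentiable ('D_u f) z, differentiable ('D_v f) z,
    `|'D_v ('D_u f) p - 'D_v ('D_u f) z| < e / 2 &
    `|'D_u ('D_v f) p - 'D_u ('D_v f) z| < e / 2].
  have nuv : \forall z \near p, `|'D_v ('D_u f) p - 'D_v ('D_u f) z| < e / 2.
    exact: (cvgrPdist_lt _ _).1 cuv _ e2.
  have nvu : \forall z \near p, `|'D_u ('D_v f) p - 'D_u ('D_v f) z| < e / 2.
    exact: (cvgrPdist_lt _ _).1 cvu _ e2.
  apply: filterS (filterI df (filterI duf (filterI dvf (filterI nuv nvu)))).
  by move=> z [? [? [? [? ?]]]]; split.
have [r /= r0 near_ball] := (nbhs_ballP _ _).1 near_uv.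
have k0 : 0 < `|u| + `|v| + 1 by rewrite ltr_wpDl// addr_ge0.
(* With this [h] the whole parallelogram stays in the ball of radius [r]; the [+ 1] keeps the
   denominator positive when [u] and [v] are both 0. *)
pose h := r / (`|u| + `|v| + 1).
have h0 : 0 < h by rewrite divr_gt0.
have in_ball s t : s \in `[0, h] -> t \in `[0, h] ->
    ball p r (p + s *: u + t *: v).
  rewrite !in_itv /= => /andP[s0 sh] /andP[t0 th].
  rewrite -ball_normE /= -addrA opprD addNKr normrN.
  rewrite (le_lt_trans (ler_normD _ _))// !normrZ !ger0_norm//.
  apply: (@le_lt_trans _ _ (h * (`|u| + `|v|))).
    by rewrite mulrDr lerD// ler_wpM2r.
  by rewrite /h mulrAC ltr_pdivrMr// ltr_pM2l// ltrDl.
have [s t sI tI|c [d [cI dI Euv]]] := @second_difference f p u v h h0.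
  by have [] := near_ball _ (in_ball _ _ sI tI).
have in_ball' t s : t \in `[0, h] -> s \in `[0, h] ->
    ball p r (p + t *: v + s *: u).
  by move=> tI sI; rewrite (addrAC p); exact: in_ball.
have [t s tI sI|d' [c' [dI' cI' Evu]]] := @second_difference f p v u h h0.
  by have [] := near_ball _ (in_ball' _ _ tI sI).
have [_ _ _ duv _] :=
  near_ball _ (in_ball _ _ (subset_itv_oo_cc cI) (subset_itv_oo_cc dI)).
have [_ _ _ _ dvu] :=
  near_ball _ (in_ball' _ _ (subset_itv_oo_cc dI') (subset_itv_oo_cc cI')).
(* Both sides, multiplied by [h] twice, are the same second difference, up to the exchange of the
   two middle terms by [swap]. *)
have E : 'D_v ('D_u f) (p + c *: u + d *: v) =
    'D_u ('D_v f) (p + d' *: v + c' *: u).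
  apply: (mulfI (lt0r_neq0 h0)); apply: (mulfI (lt0r_neq0 h0)).
  have fE : f (p + h *: v + h *: u) = f (p + h *: u + h *: v).
    by congr f; rewrite addrAC.
  by apply: (etrans (esym Euv)); apply: (etrans _ Evu); rewrite fE swap.
by apply: (triangle _ _ _ _ duv); rewrite E.
Qed.

Lemma Ck_near2_derive_comm (f : V -> R) p u v : Ck_near 2 f p ->
  'D_v ('D_u f) p = 'D_u ('D_v f) p.
Proof.
move=> [df Df]; have [duf Duf] := Df u; have [dvf Dvf] := Df v.
have cuv := nbhs_singleton (Duf v : nbhs p _).
have cvu := nbhs_singleton (Dvf u : nbhs p _).
exact: derive_comm df duf dvf cuv cvu.
Qed.

End MixedDerivatives.

(** * Symmetry of Hessians *)

Section SymmetricHessian.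
Variable R : realType.

Lemma differentiable_coef (V : normedModType R) m n (f : V -> 'M[R]_(m, n))
    i j x :
  differentiable f x -> differentiable (fun z => f z i j) x.
Proof.
by move=> df; exact: (differentiable_comp df (differentiable_coord (f x) i j)).
Qed.

Lemma hess_sym n (g : 'cV[R]_n -> R) p :
  Ck_near 2 g p -> (hess g p)^T = hess g p.
Proof.
move=> Cg; have [_ Dg] := Cg.
have dgrad v : derivable (grad g) p v.
  apply/derivable_mxP => i j.
  rewrite (_ : (fun _ => _) = 'D_(delta_mx i 0) g).
    have [dD _] := Dg (delta_mx i 0).
    exact: diff_derivable (nbhs_singleton dD).
  by apply/funext => z; rewrite mxE.
have entry i j : hess g p i j = 'D_(delta_mx j 0) ('D_(delta_mx i 0) g) p.
  rewrite mxE (derive_mx (dgrad _)) mxE; congr (derive _ _ _).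
  by apply/funext => z; rewrite mxE.
by apply/matrixP => i j; rewrite mxE !entry Ck_near2_derive_comm.
Qed.

End SymmetricHessian.

(** * State and control blocks, induction over time, and rollouts *)

Section Blocks.
Variables (R : realType) (N nx nu : nat).
Local Notation W := 'cV[R]_(wdim N nx nu).
Implicit Types (w d : W).

Lemma cur_nxt_ind (Q : 'I_N.+1 -> Prop) :
  Q ord0 -> (forall i : 'I_N, Q (cur i) -> Q (nxt i)) -> forall i, Q i.
Proof.
move=> Q0 QS [m]; elim: m => [|m IH] lt_m.
  by rewrite (_ : Ordinal _ = ord0)//; exact: val_inj.
have lt_mN : (m < N)%N by [].
rewrite (_ : Ordinal _ = nxt (Ordinal lt_mN)); last exact: val_inj.
apply: QS; rewrite (_ : cur _ = Ordinal (ltnW lt_m)); first exact: IH.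
exact: val_inj.
Qed.

(** Induction backward in time, as the Riccati recursion runs; it is an ordinary induction on the
    number [N - i] of remaining stages. *)
Lemma nxt_cur_ind (Q : 'I_N.+1 -> Prop) :
  Q ord_max -> (forall i : 'I_N, Q (nxt i) -> Q (cur i)) -> forall i, Q i.
Proof.
move=> QN QS; suff Qrev m (i : 'I_N.+1) : (N - i = m)%N -> Q i.
  by move=> i; exact: Qrev erefl.
elim: m i => [|m IH] i.
  move=> /eqP; rewrite subn_eq0 => Ni; rewrite (_ : i = ord_max)//.
  by apply/val_inj/eqP; rewrite eqn_leq Ni -ltnS ltn_ord.
move=> NiS; have lt_iN : (i < N)%N by rewrite -subn_gt0 NiS.
rewrite (_ : i = cur (Ordinal lt_iN)); last exact: val_inj.
by apply/QS/IH; rewrite /= /bump subnS NiS.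
Qed.

Lemma block_ext w d :
  (forall i, state w i = state d i) -> (forall i, control w i = control d i) ->
  w = d.
Proof.
move=> eq_x eq_u; rewrite -[w]vsubmxK -[d]vsubmxK.
by congr col_mx; apply/mxcolP => i; [exact: eq_x|exact: eq_u].
Qed.

Lemma state_linear i : linear (fun w => state w i).
Proof. by move=> a w d; rewrite /state; apply/colP => k; rewrite !mxE. Qed.

Lemma control_linear i : linear (fun w => control w i).
Proof. by move=> a w d; rewrite /control; apply/colP => k; rewrite !mxE. Qed.

Lemma stateB w d i : state (w - d) i = state w i - state d i.
Proof. exact: (zmod_morphism_linear (state_linear i)). Qed.

Lemma state0 i : state (0 : W) i = 0.
Proof. by rewrite -(subrr 0) stateB subrr. Qed.

Lemma controlB w d i : control (w - d) i = control w i - control d i.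
Proof. exact: (zmod_morphism_linear (control_linear i)). Qed.

Lemma control0 i : control (0 : W) i = 0.
Proof. by rewrite -(subrr 0) controlB subrr. Qed.

Lemma stageB w d i : stage (w - d) i = stage w i - stage d i.
Proof. by rewrite /stage stateB controlB opp_col_mx add_col_mx. Qed.

Lemma stage_linear i : linear (fun w => stage w i).
Proof.
move=> a w d; rewrite /stage scale_col_mx add_col_mx.
by rewrite state_linear control_linear.
Qed.

Definition of_blocks (x : 'I_N.+1 -> 'cV[R]_nx) (u : 'I_N -> 'cV[R]_nu) : W :=
  col_mx (\mxcol_i x i) (\mxcol_i u i).

Lemma state_of_blocks x u i : state (of_blocks x u) i = x i.
Proof. by rewrite /state col_mxKu mxcolK. Qed.

Lemma control_of_blocks x u i : control (of_blocks x u) i = u i.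
Proof. by rewrite /control col_mxKd mxcolK. Qed.

Section Rollout.
Variables (x0 : 'cV[R]_nx) (phi : 'I_N -> 'cV[R]_nx -> 'cV[R]_nu -> 'cV[R]_nx)
  (psi : 'I_N -> 'cV[R]_nx -> 'cV[R]_nu).

Definition is_rollout w := [/\ state w ord0 = x0,
  forall i, state w (nxt i) = phi i (state w (cur i)) (control w i) &
  forall i, control w i = psi i (state w (cur i))].

(** Forward in time, the law [psi] fixes each control from the state, and then [phi] fixes the next
    state. *)
Lemma rollout_unique w d : is_rollout w -> is_rollout d -> w = d.
Proof.
move=> [w0 wx wu] [d0 dx du].
have eq_x i : state w i = state d i.
  elim/cur_nxt_ind: i => [|i IH]; first by rewrite w0.
  by rewrite wx dx wu du IH.
by apply: block_ext => // i; rewrite wu du eq_x.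
Qed.

(** The recursion is on [nat], so the stage index has to be recovered by [insub]. The default 0 is
    only reached for [m] above [N], beyond the states of the problem. *)
Fixpoint rollout_state (m : nat) : 'cV[R]_nx :=
  if m is k.+1 then
    if insub k is Some i then phi i (rollout_state k) (psi i (rollout_state k))
    else 0
  else x0.

Lemma rollout_exists : exists w, is_rollout w.
Proof.
exists (of_blocks (fun i => rollout_state i)
                  (fun i => psi i (rollout_state (cur i)))).
split=> [|i|i]; rewrite ?state_of_blocks ?control_of_blocks//.
rewrite [LHS]/=; case: insubP => [j _ eq_j|]; last by rewrite ltn_ord.
by rewrite (_ : j = i)//; exact: val_inj.
Qed.

End Rollout.

Section Constraints.
Variable P : ocp R N nx nu.

Lemma stack_constraints0 c0 (c : 'I_N -> 'cV[R]_nx) (u : 'cV[R]_(udim N nu)) :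
  state (col_mx (stack_constraints c0 c) u) ord0 = c0.
Proof. by rewrite /state col_mxKu mxcolK unlift_none. Qed.

Lemma stack_constraintsS c0 (c : 'I_N -> 'cV[R]_nx) (u : 'cV[R]_(udim N nu)) i :
  state (col_mx (stack_constraints c0 c) u) (nxt i) = c i.
Proof. by rewrite /state col_mxKu mxcolK liftK. Qed.

Lemma lin_dyn_stage wb i d :
  jac (dyn P i) (stage wb i) *m stage d i
  = lin_A P wb i *m state d (cur i) + lin_B P wb i *m control d i.
Proof. by rewrite -mul_row_col hsubmxK. Qed.

End Constraints.
End Blocks.

(** * Partial derivatives of two-argument residuals, and Jacobians computed by blocks *)

Section PartialDerivatives.
Variables (R : realType) (n : nat).

(** Smoothness of the residuals is assumed jointly in both iterates, whereas the iteration matrix is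
    built from the two partial Jacobians. *)
Lemma differentiable_partial1 (V W : normedModType R) (f : V -> V -> W) x y :
  differentiable (fun z : V * V => f z.1 z.2) (x, y) ->
  differentiable (f ^~ y) x.
Proof.
move=> df.
have dp : differentiable (fun w : V => (w, y)) x.
  have did : differentiable (@id V) x by exact: ex_diff.
  exact (differentiable_pair did (differentiable_cst y x)).
exact: (differentiable_comp dp df).
Qed.

Lemma differentiable_partial2 (V W : normedModType R) (f : V -> V -> W) x y :
  differentiable (fun z : V * V => f z.1 z.2) (x, y) ->
  differentiable (f x) y.
Proof.
move=> df.
have dp : differentiable (fun w : V => (x, w)) y.
  have did : differentiable (@id V) y by exact: ex_diff.
  exact: (differentiable_pair (differentiable_cst x y) did).
exact: (differentiable_comp dp df).
Qed.

Lemma is_derive_linear_mx (W : normedModType R) (f : 'cV[R]_n -> W) x v :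
  linear f -> is_derive x v f (f v).
Proof.
move=> lf; apply: DeriveDef; last exact: derive_linear_mx.
exact: diff_derivable (differentiable_linear_mx x lf).
Qed.

Lemma is_derive_affine (U : normedModType R) (c : U) (l : 'cV[R]_n -> U) x v :
  linear l -> is_derive x v (fun z => c + l z) (l v).
Proof.
move=> ll; have dl := is_derive_linear_mx x v ll.
have := is_deriveD (is_derive_cst c x v) dl; rewrite add0r; exact.
Qed.

(** A Jacobian of stacked residuals is only ever read through its blocks: [l] extracts a block, and
    [G] is the formula for that block. *)
Lemma jac_block m k (l : 'cV[R]_m -> 'cV[R]_k) (F : 'cV[R]_n -> 'cV[R]_m)
    (G : 'cV[R]_n -> 'cV[R]_k) x v :
  linear l -> differentiable F x -> (forall z, l (F z) = G z) ->
  l (jac F x *m v) = 'D_v G x.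
Proof.
move=> ll dF lF; rewrite (jac_mul v dF) -(derive_linear_comp v ll dF).
by rewrite (_ : l \o F = G)//; apply/funext.
Qed.

Lemma iteration_unique (res : 'cV[R]_n -> 'cV[R]_n -> 'cV[R]_n) z zb :
  res z zb = 0 -> (forall z', res z' zb = 0 -> z' = z) -> iteration res zb = z.
Proof.
move=> z0 zU; apply: zU; rewrite /iteration.
exact: (xgetPex zb (ex_intro (fun y => res y zb = 0) z z0)).
Qed.

End PartialDerivatives.

(* The residuals of both methods have this shape: a forward simulation of the
   dynamics [phi] under the feedback law [psi]. *)
Section RolloutResidual.
Variables (R : realType) (N nx nu : nat).
Local Notation W := 'cV[R]_(wdim N nx nu).
Variables (res : W -> W -> W) (xi : 'cV[R]_nx)
  (phi : W -> 'I_N -> 'cV[R]_nx -> 'cV[R]_nu -> 'cV[R]_nx)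
  (psi : W -> 'I_N -> 'cV[R]_nx -> 'cV[R]_nu).
Hypothesis res0 : forall w wb, state (res w wb) ord0 = xi - state w ord0.
Hypothesis resS : forall w wb i, state (res w wb) (nxt i) =
  phi wb i (state w (cur i)) (control w i) - state w (nxt i).
Hypothesis resC : forall w wb i, control (res w wb) i =
  psi wb i (state w (cur i)) - control w i.

Lemma residual_rollout w wb :
  res w wb = 0 <-> is_rollout xi (phi wb) (psi wb) w.
Proof.
split=> [r0|[w0 wx wu]].
  split=> [|i|i]; apply/eqP; rewrite eq_sym -subr_eq0.
  - by rewrite -(res0 _ wb) r0 state0.
  - by rewrite -resS r0 state0.
  - by rewrite -resC r0 control0.
apply: block_ext => [|i]; last by rewrite resC wu subrr control0.
by elim/cur_nxt_ind => [|i _]; rewrite ?res0 ?resS ?w0 ?wx subrr state0.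
Qed.

(** Zeros of the residual are rollouts, which exist and are unique for every [wb]; no implicit
    function theorem is involved. *)
Lemma residual_unique wb : [set w | res w wb = 0] = [set iteration res wb].
Proof.
have [w /residual_rollout w0] := rollout_exists xi (phi wb) (psi wb).
have wU d : res d wb = 0 -> d = w.
  move: w0 => /residual_rollout w0 /residual_rollout d0.
  exact: rollout_unique d0 w0.
rewrite (iteration_unique w0 wU); apply/seteqP; split=> [d|_ ->//].
exact: wU.
Qed.

Variables (ws : W) (A : 'I_N -> 'M[R]_nx) (B : 'I_N -> 'M[R]_(nx, nu))
  (K : 'I_N -> 'M[R]_(nu, nx)).
Hypothesis dres : differentiable (res ^~ ws) ws.
Hypothesis dphi : forall i v, is_derive ws v
  (fun w => phi ws i (state w (cur i)) (control w i))
  (A i *m state v (cur i) + B i *m control v i).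
Hypothesis dpsi : forall i v, is_derive ws v
  (fun w => psi ws i (state w (cur i))) (K i *m state v (cur i)).

Let J := jac (res ^~ ws) ws.

Lemma jac_residual0 v : state (J *m v) ord0 = - state v ord0.
Proof.
have ds := is_derive_linear_mx ws v (@state_linear R N nx nu ord0).
have db := is_deriveB (is_derive_cst xi ws v) ds.
have dF := jac_block v (state_linear ord0) dres (fun w => res0 w ws).
apply: (etrans dF); apply: (etrans (derive_val (is_derive := db))).
exact: sub0r.
Qed.

Lemma jac_residualS v i : state (J *m v) (nxt i) =
  A i *m state v (cur i) + B i *m control v i - state v (nxt i).
Proof.
have ds := is_derive_linear_mx ws v (@state_linear R N nx nu (nxt i)).
have db := is_deriveB (dphi i v) ds.
have dF := jac_block v (state_linear (nxt i)) dres (fun w => resS w ws i).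
apply: (etrans dF); apply: (etrans (derive_val (is_derive := db))).
by [].
Qed.

Lemma jac_residualC v i :
  control (J *m v) i = K i *m state v (cur i) - control v i.
Proof.
have ds := is_derive_linear_mx ws v (@control_linear R N nx nu i).
have db := is_deriveB (dpsi i v) ds.
have dF := jac_block v (control_linear i) dres (fun w => resC w ws i).
apply: (etrans dF); apply: (etrans (derive_val (is_derive := db))).
by [].
Qed.

(** A kernel vector is a rollout from 0 of the linear dynamics [A], [B] under the feedback [K]; the
    zero vector is another, and rollouts are unique. *)
Lemma jac_residual_unit : J \in unitmx.
Proof.
apply: unitmx_kernel0 => v Jv.
apply: (@rollout_unique _ _ _ _ 0 (fun i x u => A i *m x + B i *m u)
  (fun i x => K i *m x)).
  split=> [|i|i]; apply/eqP; rewrite eq_sym -subr_eq0.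
  - by rewrite sub0r -jac_residual0 Jv state0.
  - by rewrite -jac_residualS Jv state0.
  - by rewrite -jac_residualC Jv control0.
by split=> [|i|i]; rewrite ?state0 ?control0 ?mulmx0 ?addr0.
Qed.

Lemma residual_well_defined : res ws ws = 0 -> well_defined_at res ws.
Proof.
move=> r0; split; last exact: jac_residual_unit.
  by apply: filterE; exact: residual_unique.
have := residual_unique ws; rewrite eqEsubset => -[/(_ ws r0) /= wsE _].
by rewrite -wsE.
Qed.

End RolloutResidual.

(** * The multiple shooting and DDP residuals and their Jacobians *)

Section Residuals.
Variables (R : realType) (N nx nu : nat) (P : ocp R N nx nu).
Local Notation W := 'cV[R]_(wdim N nx nu).
Implicit Types (w wb : W).

Definition lin_dynamics wb i x u : 'cV[R]_nx :=
  lin_f P wb i + lin_A P wb i *m (x - state wb (cur i))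
  + lin_B P wb i *m (u - control wb i).

Definition dynamics wb i x u : 'cV[R]_nx := dyn P i (col_mx x u).

Definition policy wb i x : 'cV[R]_nu :=
  control wb i + gain_k P wb i + gain_K P wb i *m (x - state wb (cur i)).

Lemma res_MS0 w wb : state (res_MS P w wb) ord0 = xinit P - state w ord0.
Proof. exact: stack_constraints0. Qed.

Lemma res_MSS w wb i : state (res_MS P w wb) (nxt i) =
  lin_dynamics wb i (state w (cur i)) (control w i) - state w (nxt i).
Proof. exact: stack_constraintsS. Qed.

Lemma res_MSC w wb i : control (res_MS P w wb) i =
  policy wb i (state w (cur i)) - control w i.
Proof. by rewrite /control col_mxKd mxcolK. Qed.

Lemma res_DDP0 w wb : state (res_DDP P w wb) ord0 = xinit P - state w ord0.
Proof. exact: stack_constraints0. Qed.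

Lemma res_DDPS w wb i : state (res_DDP P w wb) (nxt i) =
  dynamics wb i (state w (cur i)) (control w i) - state w (nxt i).
Proof. exact: stack_constraintsS. Qed.

Lemma res_DDPC w wb i : control (res_DDP P w wb) i =
  policy wb i (state w (cur i)) - control w i.
Proof. by rewrite /control col_mxKd mxcolK. Qed.

Lemma lin_dynamics_stage w wb i :
  lin_dynamics wb i (state w (cur i)) (control w i) =
  dyn P i (stage wb i) + jac (dyn P i) (stage wb i) *m (stage w i - stage wb i).
Proof.
by rewrite -stageB lin_dyn_stage stateB controlB /lin_dynamics addrA.
Qed.

Lemma is_derive_lin_dynamics w wb i v : is_derive w v
  (fun z => lin_dynamics wb i (state z (cur i)) (control z i))
  (lin_A P wb i *m state v (cur i) + lin_B P wb i *m control v i).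
Proof.
set J := jac (dyn P i) (stage wb i).
have lJ : linear (fun z : W => J *m stage z i).
  by move=> a x y; rewrite stage_linear linearP.
rewrite -lin_dyn_stage -/J.
have := is_derive_affine (dyn P i (stage wb i) - J *m stage wb i) w v lJ.
congr (is_derive _ _ _ _); apply/funext => z.
by rewrite lin_dynamics_stage mulmxBr [LHS]addrAC -addrA.
Qed.

Lemma is_derive_policy w wb i v : is_derive w v
  (fun z => policy wb i (state z (cur i))) (gain_K P wb i *m state v (cur i)).
Proof.
set K := gain_K P wb i.
have lK : linear (fun z : W => K *m state z (cur i)).
  by move=> a x y; rewrite state_linear linearP.
pose c := control wb i + gain_k P wb i - K *m state wb (cur i).
have := is_derive_affine c w v lK.
congr (is_derive _ _ _ _); apply/funext => z.
by rewrite /policy mulmxBr [LHS]addrAC -addrA.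
Qed.

Lemma differentiable_stage i w : differentiable (fun z : W => stage z i) w.
Proof. exact/differentiable_linear_mx/stage_linear. Qed.

Lemma derive_stage i w v : 'D_v (fun z : W => stage z i) w = stage v i.
Proof. exact/derive_linear_mx/stage_linear. Qed.

Lemma is_derive_dyn i w v : differentiable (dyn P i) (stage w i) ->
  is_derive w v (fun z : W => dyn P i (stage z i))
    (jac (dyn P i) (stage w i) *m stage v i).
Proof.
move=> df; have dc := differentiable_comp (differentiable_stage i w) df.
apply: DeriveDef; first exact: diff_derivable dc.
rewrite [X in derive X](_ : _ = dyn P i \o (fun z => stage z i))//.
by rewrite (derive_comp _ (differentiable_stage i w) df) derive_stage jac_mul.
Qed.

Section Feasible.
Variable ws : W.
Hypothesis feasible : constraints P ws = 0.

Lemma feasible_init : state ws ord0 = xinit P.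
Proof.
apply/eqP; rewrite eq_sym -subr_eq0; apply/eqP.
by rewrite -(res_DDP0 ws ws) /state col_mxKu feasible submxcol0.
Qed.

Lemma feasible_dyn i : state ws (nxt i) = dyn P i (stage ws i).
Proof.
apply/eqP; rewrite eq_sym -subr_eq0; apply/eqP.
apply: (etrans (esym (res_DDPS ws ws i))).
by rewrite /state col_mxKu feasible submxcol0.
Qed.

End Feasible.

Section FixedPoint.
Variable ws : W.
Hypothesis smooth : smooth_near P ws.

Lemma dyn_differentiable i : differentiable (dyn P i) (stage ws i).
Proof. by case: smooth => /(_ i) [/nbhs_singleton]. Qed.

Lemma is_derive_dynamics i v : is_derive ws v
  (fun z => dynamics ws i (state z (cur i)) (control z i))
  (lin_A P ws i *m state v (cur i) + lin_B P ws i *m control v i).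
Proof.
by rewrite -lin_dyn_stage; exact: is_derive_dyn (dyn_differentiable i).
Qed.

(** The entries of the Jacobian are coordinates of directional derivatives of the dynamics, which
    are differentiable by second-order smoothness. *)
Lemma jac_dyn_differentiable i a b :
  differentiable (fun z : W => jac (dyn P i) (stage z i) a b) ws.
Proof.
have [/(_ i) [_ /(_ (delta_mx b 0)) [dD _]] _ _ _ _] := smooth.
have dDi := differentiable_coef a 0 (nbhs_singleton dD).
have := differentiable_comp (differentiable_stage i ws) dDi.
congr (differentiable _ _); apply/funext => z.
by rewrite mxE.
Qed.

(** The base value [f wb] contributes [f' ws *m v] and the displacement [ws - wb] contributes its
    opposite. Second derivatives of the dynamics are multiplied by that displacement, which is 0 at
    [wb = ws]. *)
Lemma is_derive_lin_dynamics_wb i v : is_derive ws v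
  (fun wb => lin_dynamics wb i (state ws (cur i)) (control ws i)) 0.
Proof.
have dy : is_derive ws v (fun wb : W => stage ws i - stage wb i) (- stage v i).
  have := is_deriveB (is_derive_cst (stage ws i) ws v)
    (is_derive_linear_mx ws v (@stage_linear R N nx nu i)).
  by rewrite sub0r; exact.
have dfy : differentiable (fun wb : W => stage ws i - stage wb i) ws.
  exact: (differentiableB (differentiable_cst (stage ws i) ws)
           (differentiable_stage i ws)).
have [dMy DMy] := derive_mulmx_zero v (jac_dyn_differentiable i) dfy (subrr _).
have df := is_derive_dyn v (dyn_differentiable i).
have dsum := is_deriveD df (DeriveDef dMy DMy).
pose J := jac (dyn P i) (stage ws i).
have zero : J *m stage v i
    + J *m 'D_v (fun wb : W => stage ws i - stage wb i) ws = 0.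
  by case: dy => _ ->; rewrite mulmxN subrr.
have -> : (fun wb => lin_dynamics wb i (state ws (cur i)) (control ws i)) =
    (fun wb => dyn P i (stage wb i)) +
    (fun wb => jac (dyn P i) (stage wb i) *m (stage ws i - stage wb i)).
  by apply/funext => wb; exact: lin_dynamics_stage.
by rewrite -zero; exact: dsum.
Qed.

Lemma res_MS_differentiable :
  differentiable (fun z : W * W => res_MS P z.1 z.2) (ws, ws).
Proof. by case: smooth => _ _ _ [/nbhs_singleton]. Qed.

Lemma res_DDP_differentiable :
  differentiable (fun z : W * W => res_DDP P z.1 z.2) (ws, ws).
Proof. by case: smooth => _ _ _ _ [/nbhs_singleton]. Qed.

(* The blocks of the residual of the linearized dynamics do not vary with the
   linearization point to first order, and those of [res_DDP] do not at all. *)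
Lemma jac_res_wb : jac (res_MS P ws) ws = jac (res_DDP P ws) ws.
Proof.
have dMS := differentiable_partial2 res_MS_differentiable.
have dDDP := differentiable_partial2 res_DDP_differentiable.
apply: eq_mulmx_cV => v; apply: block_ext => [|i].
  elim/cur_nxt_ind => [|i _].
    apply: (etrans (jac_block v (state_linear ord0) dMS (res_MS0 ws))).
    exact: esym (jac_block v (state_linear ord0) dDDP (res_DDP0 ws)).
  have d0 := is_deriveB (is_derive_lin_dynamics_wb i v)
    (is_derive_cst (state ws (nxt i)) ws v).
  have jMS := jac_block v (state_linear (nxt i)) dMS
    (fun wb => res_MSS ws wb i).
  pose c := dynamics ws i (state ws (cur i)) (control ws i) - state ws (nxt i).
  have jDDP := @jac_block _ _ _ _ _ _ (cst c) ws v (state_linear (nxt i)) dDDP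
    (fun wb => res_DDPS ws wb i).
  apply: (etrans jMS); apply: (etrans (derive_val (is_derive := d0))).
  apply: (etrans (subrr 0)); apply: esym; apply: (etrans jDDP).
  exact: derive_cst.
have jMS := jac_block v (control_linear i) dMS (fun wb => res_MSC ws wb i).
apply: (etrans jMS).
exact: esym (jac_block v (control_linear i) dDDP (fun wb => res_DDPC ws wb i)).
Qed.

(** Linearizing at [ws] keeps the first derivative of the dynamics at [ws], and the policy is
    shared, so the block formulas of the rollout residual hold with the same matrices for both
    methods. *)
Lemma jac_res_w : jac (res_MS P ^~ ws) ws = jac (res_DDP P ^~ ws) ws.
Proof.
have dMS := differentiable_partial1 res_MS_differentiable.
have dDDP := differentiable_partial1 res_DDP_differentiable.
apply: eq_mulmx_cV => v; apply: block_ext => [|i].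
  elim/cur_nxt_ind => [|i _].
    apply: (etrans (jac_residual0 res_MS0 dMS v)).
    exact: esym (jac_residual0 res_DDP0 dDDP v).
  have dlin := is_derive_lin_dynamics ws ws.
  apply: (etrans (jac_residualS res_MSS dMS dlin v i)).
  exact: esym (jac_residualS res_DDPS dDDP is_derive_dynamics v i).
apply: (etrans (jac_residualC res_MSC dMS (is_derive_policy ws ws) v i)).
exact: esym (jac_residualC res_DDPC dDDP (is_derive_policy ws ws) v i).
Qed.

Lemma contraction_rate_eq :
  contraction_rate (res_MS P) ws = contraction_rate (res_DDP P) ws.
Proof. by rewrite /contraction_rate /iteration_matrix jac_res_w jac_res_wb. Qed.

Hypothesis feasible : constraints P ws = 0.
Hypothesis stationary : forall i, gain_k P ws i = 0.

Lemma fixed_rollout_DDP : is_rollout (xinit P) (dynamics ws) (policy ws) ws.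
Proof.
split=> [|i|i]; [exact: feasible_init|exact: feasible_dyn|].
by rewrite /policy stationary subrr mulmx0 !addr0.
Qed.

(** The linearization at [ws] agrees with the dynamics at [ws] itself. *)
Lemma fixed_rollout_MS :
  is_rollout (xinit P) (lin_dynamics ws) (policy ws) ws.
Proof.
have [w0 wx wu] := fixed_rollout_DDP.
by split=> // i; rewrite wx lin_dynamics_stage subrr mulmx0 addr0.
Qed.

Lemma res_MS_well_defined : well_defined_at (res_MS P) ws.
Proof.
have dMS := differentiable_partial1 res_MS_differentiable.
apply: (residual_well_defined res_MS0 res_MSS res_MSC dMS
  (is_derive_lin_dynamics ws ws) (is_derive_policy ws ws)).
exact/(residual_rollout res_MS0 res_MSS res_MSC)/fixed_rollout_MS.
Qed.

Lemma res_DDP_well_defined : well_defined_at (res_DDP P) ws.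
Proof.
have dDDP := differentiable_partial1 res_DDP_differentiable.
apply: (residual_well_defined res_DDP0 res_DDPS res_DDPC dDDP
  is_derive_dynamics (is_derive_policy ws ws)).
exact/(residual_rollout res_DDP0 res_DDPS res_DDPC)/fixed_rollout_DDP.
Qed.

End FixedPoint.
End Residuals.

(** * One stage of the Riccati recursion, as matrix algebra *)

Section Riccati.
Variables (R : realType) (nx nu : nat).

(** Here [x'] is the next state, [mu] its multiplier, and [gx], [gu] the stage cost gradients. With
    [H] and [h] as in the proof, stationarity in [u] reads [h + H *m x + M *m u = 0]; solving for
    [u] gives the affine law, and substituting it back gives the costate equation. *)
Lemma riccati_stage_optimal (A Q P : 'M[R]_nx) (B : 'M[R]_(nx, nu))
    (S K : 'M[R]_(nu, nx)) (T M : 'M[R]_nu) (q a p x x' gx mu : 'cV[R]_nx)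
    (r u gu kappa : 'cV[R]_nu) :
  Q^T = Q -> T^T = T -> P^T = P ->
  M = T + B^T *m P *m B -> M \in unitmx ->
  K = - (invmx M *m (S + B^T *m P *m A)) ->
  kappa = - (invmx M *m (r + B^T *m (P *m a + p))) ->
  x' = a + A *m x + B *m u ->
  gx = q + Q *m x + S^T *m u -> gu = r + S *m x + T *m u ->
  P *m x' + p = mu -> gu + B^T *m mu = 0 ->
  let Pi := Q + A^T *m P *m A + (S^T + A^T *m P *m B) *m K in
  let pi := q + A^T *m (P *m a + p) + K^T *m (r + B^T *m (P *m a + p)) in
  [/\ kappa + K *m x - u = 0, Pi^T = Pi & Pi *m x + pi = gx + A^T *m mu].
Proof.
move=> Qs Ts Ps defM uM defK defk defx' defgx defgu defmu gu0 Pi pi.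
(* [H] and [h] are introduced opaquely, so that they stay atomic until [defH] and [defh] are
   used. *)
have [H defH] : exists H, H = S + B^T *m P *m A by eexists.
have [h defh] : exists h, h = r + B^T *m (P *m a + p) by eexists.
have HT : S^T + A^T *m P *m B = H^T.
  by rewrite defH linearD /= !trmx_mul trmxK Ps mulmxA.
have MT : M^T = M.
  by rewrite defM linearD /= !trmx_mul trmxK Ps Ts mulmxA.
rewrite /Pi /pi HT -defh; rewrite -defH in defK; rewrite -defh in defk.
have KT : K^T = - (H^T *m invmx M).
  by rewrite defK linearN /= trmx_mul trmx_inv MT.
have hHx : h + H *m x + M *m u = 0.
  rewrite -gu0 defgu -defmu defx' defh defH defM.
  rewrite !(mulmxDr, mulmxDl, mulmxA).
  by apply/colP => k; rewrite !addmxE; ring.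
have uE : kappa + K *m x = u.
  move/eqP: hHx; rewrite addr_eq0 => /eqP hHx.
  rewrite defk defK mulNmx -opprD -mulmxA -mulmxDr hHx.
  by rewrite mulmxN opprK mulKmx.
split; first by rewrite uE subrr.
  have HKT : (H^T *m K)^T = H^T *m K.
    by rewrite trmx_mul trmxK KT defK mulmxN mulNmx mulmxA.
  by rewrite !linearD /= HKT Qs !trmx_mul trmxK Ps mulmxA.
(* Both sides are [- H^T *m invmx M *m h], by symmetry of [M]. This brings out the sum
   [kappa + K *m x], which is [u]. *)
have -> : K^T *m h = H^T *m kappa by rewrite KT defk mulmxN mulNmx mulmxA.
transitivity (q + Q *m x + A^T *m (P *m (a + A *m x) + p)
              + H^T *m (kappa + K *m x)).
  rewrite !(mulmxDr, mulmxDl, mulmxA).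
  by apply/colP => k; rewrite !addmxE; ring.
rewrite uE defgx -defmu defx' -HT !(mulmxDr, mulmxDl, mulmxA).
by apply/colP => k; rewrite !addmxE; ring.
Qed.

End Riccati.

(** * The KKT conditions stage by stage, and the Riccati costates *)

Section Stationarity.
Variables (R : realType) (N nx nu : nat) (P : ocp R N nx nu).
Local Notation W := 'cV[R]_(wdim N nx nu).
Variables (ws : W) (lam : 'cV[R]_(xdim N nx)).
Hypothesis smooth : smooth_near P ws.

Let gl i := grad (stage_cost P i) (stage ws i).
Let gN := grad (final_cost P) (state ws ord_max).
(** The index is that of the state being constrained: [mu ord0] belongs to the initial condition and
    [mu (nxt i)] to the dynamics of stage [i]. *)
Let mu i : 'cV[R]_nx := submxcol lam i.

Lemma derive_objective d : ((grad (objective P) ws)^T *m d) 0 0 =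
  \sum_(i < N) ((gl i)^T *m stage d i) 0 0 + (gN^T *m state d ord_max) 0 0.
Proof.
have [_ dl [/nbhs_singleton dlN _] _ _] := smooth.
have dli i : differentiable (stage_cost P i) (stage ws i).
  by have [/nbhs_singleton] := dl i.
have ds i : differentiable (fun w : W => stage_cost P i (stage w i)) ws.
  exact: (differentiable_comp (differentiable_stage i ws) (dli i)).
have dx : differentiable (fun w : W => state w ord_max) ws.
  exact: (differentiable_linear_mx ws (state_linear ord_max)).
have dsN : differentiable (fun w : W => final_cost P (state w ord_max)) ws.
  exact: (differentiable_comp dx dlN).
have dsum := differentiable_sum ds.
have objE : objective P = \sum_(i < N) (fun w : W => stage_cost P i (stage w i))
    + (fun w : W => final_cost P (state w ord_max)).
  by apply/funext => w; rewrite fct_sumE.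
have dobj : differentiable (objective P) ws.
  by rewrite objE; exact: differentiableD dsum dsN.
rewrite (grad_mul d dobj) objE.
apply: (etrans (deriveD (diff_derivable dsum) (diff_derivable dsN))).
congr (_ + _).
  apply: (etrans (derive_sum (fun i => diff_derivable (ds i)))).
  apply: eq_bigr => i _; rewrite (grad_mul _ (dli i)).
  apply: (etrans (derive_comp d (differentiable_stage i ws) (dli i))).
  by rewrite derive_stage.
rewrite (grad_mul _ dlN).
apply: (etrans (derive_comp d dx dlN)).
by rewrite (derive_linear_mx ws d (state_linear ord_max)).
Qed.

(** The constraints are the upper block of the DDP residual, so the block formulas for its Jacobian
    can be reused. *)
Lemma jac_constraints d :
  jac (constraints P) ws *m d =
  @usubmx R (xdim N nx) (udim N nu) 1 (jac (res_DDP P ^~ ws) ws *m d).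
Proof.
have dDDP := differentiable_partial1 (res_DDP_differentiable smooth).
have lu : linear (@usubmx R (xdim N nx) (udim N nu) 1).
  by move=> a x y; rewrite linearP.
have dc : differentiable (constraints P) ws.
  have := differentiable_comp dDDP (differentiable_linear_mx _ lu).
  congr (differentiable _ _); apply/funext => w.
  exact: col_mxKu.
rewrite (jac_mul d dc); apply: esym.
by apply: (jac_block d lu dDDP) => w; exact: col_mxKu.
Qed.

Lemma multiplier_constraints d : (lam^T *m (jac (constraints P) ws *m d)) 0 0 =
  \sum_(i < N)
    (((jac (dyn P i) (stage ws i))^T *m mu (nxt i))^T *m stage d i) 0 0
  - \sum_(i < N.+1) ((mu i)^T *m state d i) 0 0.
Proof.
have dDDP := differentiable_partial1 (res_DDP_differentiable smooth).
set J := jac (res_DDP P ^~ ws) ws.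
have -> : (lam^T *m (jac (constraints P) ws *m d)) 0 0 =
    \sum_(i < N.+1) ((mu i)^T *m state (J *m d) i) 0 0.
  rewrite jac_constraints -/J -[lam]submxcolK tr_mxcol.
  rewrite -[usubmx _]submxcolK mul_mxrow_mxcol summxE.
  by [].
(* Both sums over [N.+1] are split at index 0; the remaining terms are indexed by the stages through
   [nxt]. *)
have dE := @big_ord_recl R 0 +%R N (fun i => ((mu i)^T *m state d i) 0 0).
rewrite [LHS]big_ord_recl dE opprD [RHS]addrCA; congr (_ + _).
  by rewrite (jac_residual0 (@res_DDP0 _ _ _ _ P) dDDP) mulmxN mxE.
rewrite -sumrB; apply: eq_bigr => i _; rewrite -/(nxt i).
rewrite (jac_residualS (@res_DDPS _ _ _ _ P) dDDP (is_derive_dynamics smooth)).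
by rewrite -lin_dyn_stage trmx_mul trmxK mulmxBr mulmxA !mxE.
Qed.

Hypothesis kkt : KKT P ws lam.

(** [ex i], [eu i] and [eN] are the partial gradients of the Lagrangian in the state and control of
    stage [i] and in the final state. *)
Let ex i := usubmx (gl i) + (lin_A P ws i)^T *m mu (nxt i) - mu (cur i).
Let eu i := dsubmx (gl i) + (lin_B P ws i)^T *m mu (nxt i).
Let eN := gN - mu ord_max.

Lemma dot_stage (y : 'cV[R]_(nx + nu)) (d : W) i : (y^T *m stage d i) 0 0 =
  ((usubmx y)^T *m state d (cur i)) 0 0 + ((dsubmx y)^T *m control d i) 0 0.
Proof. by rewrite -{1}[y]vsubmxK tr_col_mx mul_row_col mxE. Qed.

Lemma stationarity_sum d :
  \sum_(i < N) (((ex i)^T *m state d (cur i)) 0 0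
                + ((eu i)^T *m control d i) 0 0)
  + (eN^T *m state d ord_max) 0 0 = 0.
Proof.
have : ((grad (objective P) ws)^T *m d) 0 0
    + (lam^T *m (jac (constraints P) ws *m d)) 0 0 = 0.
  have [_ /(congr1 trmx)] := kkt; rewrite linearD /= trmx_mul trmxK trmx0.
  by move=> g0; rewrite mulmxA -addmxE -mulmxDl g0 mul0mx mxE.
(* Here the last index is split off instead: the remaining multipliers pair with the states [cur i]
   that enter the stages. *)
have dE := @big_ord_recr R 0 +%R N (fun i => ((mu i)^T *m state d i) 0 0).
rewrite derive_objective multiplier_constraints dE => eq0.
apply: (etrans _ eq0).
pose J i := jac (dyn P i) (stage ws i).
have termE i : ((ex i)^T *m state d (cur i)) 0 0 + ((eu i)^T *m control d i) 0 0
    = ((gl i)^T *m stage d i) 0 0 + (((J i)^T *m mu (nxt i))^T *m stage d i) 0 0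
      - ((mu (cur i))^T *m state d (cur i)) 0 0.
  rewrite !dot_stage -!mul_usub_mx -!mul_dsub_mx -trmx_lsub -trmx_rsub.
  by rewrite dotB !dotD; ring.
rewrite dotB; under eq_bigr => i _ do rewrite termE.
by rewrite sumrB big_split /=; ring.
Qed.

Lemma KKT_blocks :
  [/\ forall i, usubmx (gl i) + (lin_A P ws i)^T *m mu (nxt i) = mu (cur i),
      forall i, dsubmx (gl i) + (lin_B P ws i)^T *m mu (nxt i) = 0 &
      gN = mu ord_max].
Proof.
have cur_lift i : cur i = lift ord_max i.
  by apply/val_inj; rewrite [RHS]lift_max.
(* The test direction is the gradient of the Lagrangian itself, so the vanishing sum is a sum of
   squares and every block is 0. As [cur i] is [lift ord_max i], [unlift ord_max] separates the
   final state from the others. *)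
pose d : W := of_blocks
  (fun j => if unlift ord_max j is Some i then ex i else eN) eu.
have := stationarity_sum d.
rewrite state_of_blocks unlift_none.
under eq_bigr => i _ do
  rewrite state_of_blocks control_of_blocks cur_lift liftK.
move=> /eqP; rewrite paddr_eq0 ?sqmx_ge0//; last first.
  by apply: sumr_ge0 => i _; rewrite addr_ge0 ?sqmx_ge0.
move=> /andP[/eqP sum0 /eqP/sqmx_eq0 eN0].
have ei0 i : ((ex i)^T *m ex i) 0 0 + ((eu i)^T *m eu i) 0 0 = 0.
  apply: (psumr_eq0P _ sum0) => // j _.
  by rewrite addr_ge0 ?sqmx_ge0.
have ei i : ex i = 0 /\ eu i = 0.
  move: (ei0 i) => /eqP; rewrite paddr_eq0 ?sqmx_ge0//.
  by move=> /andP[/eqP/sqmx_eq0 -> /eqP/sqmx_eq0 ->].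
split=> [i|i|]; last exact: subr0_eq.
  by have [/subr0_eq] := ei i.
by have [] := ei i.
Qed.

Hypothesis regular : riccati_regular P ws.

(** The offsets in [lin_a], [ggn_q] and [ggn_r] make the affine models reproduce, at the
    linearization point, the true next state and the true cost gradients, as the stage algebra
    requires. *)
Lemma gain_costate i (Pp := riccati P ws (nxt i)) :
  (Pp.1)^T = Pp.1 -> Pp.1 *m state ws (nxt i) + Pp.2 = mu (nxt i) ->
  [/\ gain_k P ws i = 0,
      ((riccati_step P ws i Pp).1)^T = (riccati_step P ws i Pp).1 &
      (riccati_step P ws i Pp).1 *m state ws (cur i)
        + (riccati_step P ws i Pp).2
      = usubmx (gl i) + (lin_A P ws i)^T *m mu (nxt i)].
Proof.
move=> Ps Pmu; have [_ /(_ i) Cl _ _ _] := smooth; have [feasible _] := kkt.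
have [_ eu0 _] := KKT_blocks.
have hs : (ggn_hess P ws i)^T = ggn_hess P ws i := hess_sym Cl.
apply: (@riccati_stage_optimal R nx nu (lin_A P ws i) (ggn_Q P ws i) Pp.1
  (lin_B P ws i) (ggn_S P ws i) (riccati_K P ws i Pp) (ggn_R P ws i)
  (riccati_M P ws i Pp) (ggn_q P ws i) (lin_a P ws i) Pp.2
  (state ws (cur i)) (state ws (nxt i)) (usubmx (gl i)) (mu (nxt i))
  (ggn_r P ws i) (control ws i) (dsubmx (gl i)) (riccati_kappa P ws i Pp)).
- by rewrite /ggn_Q trmx_ulsub hs.
- by rewrite /ggn_R trmx_drsub hs.
- exact: Ps.
- by [].
- exact: regular.
- by [].
- by [].
- by rewrite (feasible_dyn feasible) /lin_a [RHS]addrAC !subrK.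
- by rewrite /ggn_q -/(gl i) addrAC !subrK.
- by rewrite /ggn_r -/(gl i) addrAC !subrK.
- exact: Pmu.
- exact: eu0.
Qed.

(** At the end of the horizon, [final_p] turns the affine expression into the gradient of the final
    cost, which is the last multiplier. Each step back is the costate equation in [KKT_blocks]. *)
Lemma riccati_costate j :
  ((riccati P ws j).1)^T = (riccati P ws j).1 /\
  (riccati P ws j).1 *m state ws j + (riccati P ws j).2 = mu j.
Proof.
have [ex0 _ eN0] := KKT_blocks.
elim/nxt_cur_ind: j => [|i [Ps Pmu]].
  have [_ _ CN _ _] := smooth; rewrite riccati_final; split.
    exact: hess_sym CN.
  by rewrite /= /final_p addrC subrK.
by have [_ ? Pmui] := gain_costate Ps Pmu; rewrite riccatiE Pmui ex0.
Qed.

Lemma gain_k_eq0 i : gain_k P ws i = 0.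
Proof.
by have [Ps Pmu] := riccati_costate (nxt i); have [] := gain_costate Ps Pmu.
Qed.

End Stationarity.

(** Well-definedness comes with the equality: it ensures that the two rates are those of genuine
    iterations with fixed point [ws], and not of default values of [iteration] or [invmx]. *)
Theorem proposition2 (R : realType) (N nx nu : nat) (P : ocp R N nx nu)
    (ws : 'cV[R]_(wdim N nx nu)) (lams : 'cV[R]_(xdim N nx)) :
  (0 < N)%N ->
  convex_costs P ->
  smooth_near P ws ->
  riccati_regular P ws ->
  KKT P ws lams ->
  LICQ P ws ->
  SOSC P ws lams ->
  [/\ well_defined_at (res_MS P) ws,
      well_defined_at (res_DDP P) ws &
      contraction_rate (res_MS P) ws = contraction_rate (res_DDP P) ws].
Proof.
move=> _ _ smooth regular kkt _ _.
have [feasible _] := kkt.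
have stationary := gain_k_eq0 smooth kkt regular.
split.
- exact: res_MS_well_defined smooth feasible stationary.
- exact: res_DDP_well_defined smooth feasible stationary.
- exact: contraction_rate_eq.
Qed.
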